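(* Consider the agglomeration phase of P-RASTER (described in the context) applied to a finite set $S\subset\mathbb{Z}^2$ of significant tiles, with minimum cluster size $\mu$ and arbitrary borders $b_1<\dots<b_{N-1}$. Let $C_1,\dots,C_r$ be per-slice clusters lying in several (possibly more than two) slices such that $C_1\cup\dots\cup C_r$ is connected in the neighbor graph on $S$, i.e. the union forms one cluster that crosses one or more borders. Then, when the algorithm terminates, $C_1,\dots,C_r$ have all been joined into one and the same joined cluster, regardless of how many borders this union crosses.
   Context: Tiles are integer grid cells $(x,y)\in\mathbb{Z}^2$. Two tiles are neighbors if their Chebyshev distance is exactly $1$ (the eight surrounding cells). For a set of tiles, its clusters are the connected components of the graph on those tiles whose edges join neighboring tiles. Two sets of tiles are adjacent if some tile of one is a neighbor of some tile of the other. P-RASTER agglomeration. Input: a finite set $S$ of significant tiles, a minimum cluster size $\mu$, and integers $b_1<\dots<b_{N-1}$ (vertical borders). Put $b_0=-\infty$, $b_N=+\infty$; slice $k$ ($1\le k\le N$) consists of the tiles of $S$ with $b_{k-1}\le x<b_k$, and border $B_k$ ($1\le k\le N-1$) separates slices $k$ and $k+1$. A set of tiles touches $B_k$ if it contains a tile with $x=b_k-1$ or $x=b_k$. Step 1 (in parallel per slice): compute the clusters of the tiles of each slice (per-slice clusters); a per-slice cluster touching some border is put into the candidate set $C_b$; otherwise it is output if it has at least $\mu$ tiles and discarded otherwise. Step 2 (joining, for $i=N-1,N-2,\dots,1$ in this order): let $C_{lr}$ be the clusters in $C_b$ that touch $B_i$; repeatedly merge clusters of $C_{lr}$ that are adjacent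 (a depth-first search over clusters, merging each newly found adjacent cluster into the current joined cluster) until the elements of $C_{lr}$ are grouped into maximal joined clusters; each joined cluster that touches $B_{i-1}$ is returned to $C_b$ as a candidate for the next border (replacing its constituents), and each other joined cluster is output if it has at least $\mu$ tiles and discarded otherwise. The output is the set of all output clusters. *)

(* Defs.v *)
From mathcomp Require Import all_boot all_order all_algebra.
From mathcomp Require Import finmap.

Set Implicit Arguments.
Unset Strict Implicit.
Unset Printing Implicit Defensive.

Import Order.TTheory GRing.Theory Num.Theory.

Local Open Scope fset_scope.
Local Open Scope ring_scope.

Notation tile := (int * int)%type (only parsing).
Notation tileset := {fset int * int} (only parsing).

Definition neighbor (p q : tile) : bool :=
  Num.max `|p.1 - q.1| `|p.2 - q.2| == 1.

Definition adjacent (A B : tileset) : bool :=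
  [exists p : A, [exists q : B, neighbor (val p) (val q)]].

(* A finite set T is coerced to the finite type of its elements: this is the
   subgraph of the neighbor graph induced by T. *)
Definition tile_graph (T : tileset) : rel T :=
  fun p q => neighbor (val p) (val q).

Definition connected (T : tileset) : Prop :=
  forall p q : T, connect (@tile_graph T) p q.

Definition component (T : tileset) (p : T) : tileset :=
  [fset val q | q in connect (@tile_graph T) p].

Definition clusters (T : tileset) : {fset tileset} :=
  [fset component p | p in {: T}].

Section Borders.

(* The list bs = [:: b_1; ...; b_(N-1)] determines N = (size bs).+1. *)
Variable bs : seq int.

(* b_k for 0 <= k <= N, as the left end of an interval: b_0 = -oo, b_N = +oo
   (the default value of nth). *)
Definition border (k : nat) : itv_bound int :=
  nth +oo%O (-oo%O :: [seq BLeft b | b <- bs]) k.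

(* Slice k, for 1 <= k <= N: the tiles of S with b_(k-1) <= x < b_k. *)
Definition slice (S : tileset) (k : nat) : tileset :=
  [fset t in S | t.1 \in Interval (border k.-1) (border k)].

(* The set C contains a tile with x = b_k - 1 or x = b_k; this never holds for
   the infinite borders b_0 and b_N. *)
Definition touches (k : nat) (C : tileset) : bool :=
  [exists t : C, (BLeft ((val t).1 + 1) == border k)
                 || (BLeft (val t).1 == border k)].

Definition touches_some (C : tileset) : bool :=
  has (touches^~ C) (iota 1 (size bs)).

Definition per_slice_clusters (S : tileset) : {fset tileset} :=
  \bigcup_(k <- iota 1 (size bs).+1) clusters (slice S k).

End Borders.

(* Depth-first search over clusters, with an explicit stack: J is the current
   joined cluster, rest the clusters not found yet.  Each of the n steps either
   finds a cluster of rest adjacent to the top of the stack, merges it into J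
   and pushes it, or else pops the stack.  The number of steps still needed is
   at most (size rest).*2 + size stack. *)
Fixpoint dfs_join (n : nat) (J : tileset) (stack rest : seq tileset) :
    tileset * seq tileset :=
  match n, stack with
  | n'.+1, C :: stack' =>
      if has (adjacent C) rest then
        let D := nth fset0 rest (find (adjacent C) rest) in
        dfs_join n' (J `|` D) (D :: stack) (rem D rest)
      else dfs_join n' J stack' rest
  | _, _ => (J, rest)
  end.

(* Joined clusters of a list, at most n of them. *)
Fixpoint join_seq (n : nat) (Clr : seq tileset) : seq tileset :=
  match n, Clr with
  | n'.+1, C :: rest =>
      let: (J, rest') := dfs_join (size rest).*2.+1 C [:: C] rest in
      J :: join_seq n' rest'
  | _, _ => [::]
  end.

Definition join_clusters (Clr : {fset tileset}) : {fset tileset} :=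
  [fset J in join_seq #|` Clr| Clr].

Record state := State {
  candidates : {fset tileset};  (* C_b *)
  joined : {fset tileset};      (* joined clusters not returned to C_b,
                                   whether output or discarded *)
  output : {fset tileset}
}.

Section Algorithm.

Variables (S : tileset) (mu : nat) (bs : seq int).

Definition large (C : tileset) : bool := (mu <= #|` C|)%N.

Definition step1 : state :=
  let Cs := per_slice_clusters bs S in
  State [fset C in Cs | touches_some bs C] fset0
        [fset C in Cs | ~~ touches_some bs C && large C].

Definition step2 (st : state) (i : nat) : state :=
  let Clr := [fset C in candidates st | touches bs i C] in
  let Js := join_clusters Clr in
  let final := [fset J in Js | ~~ touches bs i.-1 J] in
  State ((candidates st `\` Clr) `|` [fset J in Js | touches bs i.-1 J])
        (joined st `|` final)
        (output st `|` [fset J in final | large J]).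

(* Step 2 is run for i = N - 1, N - 2, ..., 1. *)
Definition praster : state := foldl step2 step1 (rev (iota 1 (size bs))).

End Algorithm.

(* Main.v *)
(* Two neighboring tiles are separated by at most one border, and then both touch
   it.  Before border B_i is processed, every candidate and every joined cluster is
   closed under those edges of the neighbor graph on S that cross none of the borders
   B_1, ..., B_i; processing B_i adds the edges crossing B_i, because all candidates
   touching B_i take part in the join.  After the last border the candidate set is
   empty and all joined clusters are closed under all edges, so the joined cluster
   containing a border tile of a connected union contains the whole union. *)

Require Import Defs.
From mathcomp Require Import all_boot all_order all_algebra.
From mathcomp Require Import finmap.
From mathcomp Require Import zify.

Import Order.TTheory GRing.Theory Num.Theory.
Local Open Scope ring_scope.
Local Open Scope fset_scope.

(** * Neighboring tiles and the depth-first join of adjacent clusters *)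

Lemma neighborC (p q : int * int) : neighbor p q = neighbor q p.
Proof. by rewrite /neighbor distrC (distrC p.2). Qed.

Lemma neighbor_x (p q : int * int) : neighbor p q -> `|p.1 - q.1| <= 1.
Proof. by rewrite /neighbor => /eqP <-; rewrite le_max lexx. Qed.

Lemma adjacentP (A B : {fset int * int}) :
  reflect (exists p q, [/\ p \in A, q \in B & neighbor p q]) (adjacent A B).
Proof.
apply: (iffP existsP) => [[p /existsP[q pq]]|[p [q [pA qB pq]]]].
  by exists (val p), (val q); split => //; apply: valP.
by exists [` pA]; apply/existsP; exists [` qB].
Qed.

(* The hypothesis on J says that a tile of J which may still have neighbors in
   rest lies in a cluster that is still on the stack. *)
Lemma dfs_joinP (n : nat) (J : {fset int * int}) (stack rest : seq {fset int * int}) J' rest' :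
    ((size rest).*2 + size stack <= n)%N ->
    (forall p, p \in J -> (exists2 C, C \in stack & p \in C) \/
       forall D q, D \in rest -> q \in D -> ~~ neighbor p q) ->
    dfs_join n J stack rest = (J', rest') ->
  [/\ J `<=` J',
      {subset rest' <= rest} /\ (size rest' <= size rest)%N,
      forall D, D \in rest -> D `<=` J' \/ D \in rest',
      forall p, p \in J' -> p \in J \/ exists2 D, D \in rest & p \in D /\ D `<=` J'
    & forall p D q, p \in J' -> D \in rest' -> q \in D -> ~~ neighbor p q].
Proof.
elim: n J stack rest => [|n IH] J [|C stack] rest /= hn hJ.
- case=> <- <-; split; [by []|by split|by right|by left|by move=> p D q /hJ[[]//|]; apply].
- by move: hn; lia.
- case=> <- <-; split; [by []|by split|by right|by left|by move=> p D q /hJ[[]//|]; apply].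
case: ifPn => [/[dup] hasC /(nth_find fset0)|nC].
  set D := nth _ _ _ => CD.
  have Drest : D \in rest by rewrite mem_nth // -has_find.
  have prem := perm_to_rem Drest.
  have memr E : (E \in rest) = (E == D) || (E \in rem D rest).
    by rewrite (perm_mem prem) inE.
  have sz : size rest = (size (rem D rest)).+1 by rewrite (perm_size prem).
  case/IH.
  - by move: hn; rewrite sz /=; lia.
  - move=> p; rewrite in_fsetU => /orP[/hJ[[E Es pE]|hp]|pD].
    + by left; exists E => //; rewrite inE Es orbT.
    + by right=> E q Er; apply: hp; apply: mem_rem Er.
    + by left; exists D => //; rewrite inE eqxx.
  move=> JD [sub le] cov uni sep; split.
  - exact: fsubset_trans (fsubsetUl _ _) JD.
  - by split; [move=> E /sub /mem_rem | rewrite sz ltnW].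
  - move=> E; rewrite memr => /orP[/eqP ->|/cov //].
    by left; apply: fsubset_trans (fsubsetUr _ _) JD.
  - move=> p /uni[|[E /mem_rem ? ?]]; last by right; exists E.
    rewrite in_fsetU => /orP[|pD]; first by left.
    by right; exists D => //; split=> //; apply: fsubset_trans (fsubsetUr _ _) JD.
  - exact: sep.
case/IH => //; first by move: hn; lia.
move=> p /hJ[[E]|]; last by right.
rewrite inE => /orP[/eqP -> pC|Es pE]; last by left; exists E.
(* Popping [C] is safe: a tile of [C] with a neighbor in [rest] would make [C] adjacent to some
   remaining cluster, contrary to [nC]. *)
right=> D q Dr qD; apply: contra nC => pq.
by apply/hasP; exists D => //; apply/adjacentP; exists p, q.
Qed.

(** The third clause is the maximality of joined clusters, stated tile by tile. It holds because
    each search leaves behind only clusters without a neighbor in its result, so no later joined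
    cluster can be adjacent to an earlier one. *)
Lemma join_seqP (n : nat) (l : seq {fset int * int}) : (size l <= n)%N ->
  [/\ forall D, D \in l -> exists2 J, J \in join_seq n l & D `<=` J,
      forall J p, J \in join_seq n l -> p \in J ->
        exists2 D, D \in l & p \in D /\ D `<=` J
    & forall J p D q, J \in join_seq n l -> p \in J -> D \in l -> q \in D ->
        neighbor p q -> q \in J].
Proof.
elim: n l => [|n IH] [|C rest] // hn.
case E: (dfs_join (size rest).*2.+1 C [:: C] rest) => [J rest'].
have -> : join_seq n.+1 (C :: rest) = J :: join_seq n rest'.
  by rewrite -[LHS]/(let: (J, r) := dfs_join _ _ _ _ in J :: join_seq n r) E.
have [||CJ [sub le] cov uni sep] := dfs_joinP _ _ _ _ _ _ _ _ E.
- by rewrite addn1.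
- by move=> p pC; left; exists C; rewrite ?inE.
have [cov' uni' clo'] := IH rest' (leq_trans le hn).
have covC D : D \in C :: rest -> D `<=` J \/ D \in rest'.
  by rewrite inE => /orP[/eqP ->|/cov //]; left.
split.
- move=> D /covC[DJ|/cov'[K Kj DK]]; first by exists J; rewrite ?inE ?eqxx.
  by exists K; rewrite ?inE ?Kj ?orbT.
- move=> K p; rewrite inE => /orP[/eqP -> /uni[pC|[D Dr pD]]|Kj].
  + by exists C; rewrite ?inE ?eqxx.
  + by exists D; rewrite ?inE ?Dr ?orbT.
  + by case/(uni' _ _ Kj) => D /sub Dr ?; exists D; rewrite ?inE ?Dr ?orbT.
- move=> K p D q; rewrite inE => /orP[/eqP -> pJ|Kj pK] /covC[DJ|Dr] qD pq.
  + exact: (fsubsetP DJ).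
  + by have := sep _ _ _ pJ Dr qD; rewrite pq.
  (* Here [q] lies in the first joined cluster [J] and [p] in a later one, hence in some cluster of
     [rest']. The separation [sep] forbids this edge once it is read from [q] to [p]. *)
  + have [D' D'r [pD' _]] := uni' _ _ Kj pK.
    by have := sep _ _ _ (fsubsetP DJ _ qD) D'r pD'; rewrite neighborC pq.
  + exact: (clo' K p D q).
Qed.

(** * Paths and connected components of tile sets *)

Lemma connect_ind {T : finType} (e : rel T) (P : T -> Prop) :
  (forall x y, e x y -> P x -> P y) -> forall x y, connect e x y -> P x -> P y.
Proof.
move=> eP x y /connectP[s + ->]; elim: s x => //= z s IH x /andP[xz zs] Px.
exact: IH zs (eP _ _ xz Px).
Qed.

Lemma eq_BLeft {T : eqType} (x y : T) : (BLeft x == BLeft y) = (x == y).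
Proof. by []. Qed.

Lemma clustersP (T D : {fset int * int}) :
  reflect (exists p : T, D = component p) (D \in clusters T).
Proof.
by apply: (iffP (imfsetP _ _ _ _)) => [[p _ ->]|[p ->]]; exists p.
Qed.

Lemma mem_component {T : {fset int * int}} (p : T) : val p \in component p.
Proof. by apply/imfsetP; exists p => //; apply: connect0. Qed.

Lemma component_sub {T : {fset int * int}} (p : T) : component p `<=` T.
Proof. by apply/fsubsetP => _ /imfsetP[q _ ->]; apply: valP. Qed.

Lemma component_closed {T : {fset int * int}} (p : T) (x y : int * int) :
  x \in component p -> y \in T -> neighbor x y -> y \in component p.
Proof.
case/imfsetP => q pq -> yT qy; apply/imfsetP; exists [` yT] => //.
by apply: connect_trans pq (connect1 _).
Qed.

(** * Position of tiles relative to the borders *)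

Section Borders.
Variable bs : seq int.

(** Comparing interval bounds treats the infinite borders uniformly: it is always true at index [0]
    and never true beyond [size bs]. *)
Definition right_of (k : nat) (t : int * int) : bool :=
  (border bs k <= BLeft t.1)%O.

Definition on_border (k : nat) (t : int * int) : bool :=
  (BLeft (t.1 + 1)%R == border bs k) || (BLeft t.1 == border bs k).

Lemma touchesP (k : nat) (C : {fset int * int}) :
  reflect (exists2 t, t \in C & on_border k t) (touches bs k C).
Proof.
apply: (iffP existsP) => [[t ht]|[t tC ht]].
  by exists (val t) => //; apply: valP.
by exists [` tC].
Qed.

Variant border_spec (k : nat) : itv_bound int -> Prop :=
  | BorderFirst of k = 0%N : border_spec k -oo%O
  | BorderMid of (0 < k <= size bs)%N : border_spec k (BLeft (nth 0 bs k.-1))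
  | BorderLast of (size bs < k)%N : border_spec k +oo%O.

Lemma borderP (k : nat) : border_spec k (border bs k).
Proof.
rewrite /border; case: k => [|k] /=; first exact: BorderFirst.
have [kb|kb] := ltnP k (size bs).
  by rewrite (nth_map 0) //; apply: BorderMid.
by rewrite nth_default ?size_map //; apply: BorderLast.
Qed.

Lemma on_border_range (k : nat) (t : int * int) :
  on_border k t -> (0 < k <= size bs)%N.
Proof. by rewrite /on_border; case: borderP. Qed.

Lemma right_of0 (t : int * int) : right_of 0 t.
Proof. by []. Qed.

Lemma right_of_last (t : int * int) : ~~ right_of (size bs).+1 t.
Proof. by rewrite /right_of; case: borderP => //; lia. Qed.

(** The columns of neighbors differ by at most one, so two neighbors separated by the border [b]
    occupy the columns [b - 1] and [b]. *)
Lemma neighbor_cross (k : nat) (p q : int * int) :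
  neighbor p q -> right_of k p != right_of k q -> on_border k p && on_border k q.
Proof.
move/neighbor_x; rewrite /on_border /right_of.
by case: borderP => // _; rewrite !eq_BLeft !bnd_simp; lia.
Qed.

Lemma mem_slice (S : {fset int * int}) (k : nat) (t : int * int) :
  (t \in slice bs S k) = [&& t \in S, right_of k.-1 t & ~~ right_of k t].
Proof.
rewrite in_fset inE /= itv_boundlr /right_of -ltNge; congr [&& _, _ & _].
Qed.

(** The slice index is the least [k] such that [t] is left of border [k]; index [0] never qualifies
    and [(size bs).+1] always does. *)
Lemma mem_some_slice (S : {fset int * int}) (t : int * int) : t \in S ->
  exists2 k, (0 < k <= (size bs).+1)%N & t \in slice bs S k.
Proof.
move=> tS; have ex : exists k, ~~ right_of k t.
  by exists (size bs).+1; apply: right_of_last.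
case: (ex_minnP ex) => k kt kmin; exists k.
  rewrite kmin ?right_of_last // andbT lt0n.
  by apply: contra kt => /eqP ->; rewrite right_of0.
rewrite mem_slice tS kt andbT /=.
by case: k kt kmin => // k _ kmin /=; apply: contraT => /kmin; rewrite ltnn.
Qed.

Hypothesis hbs : sorted <%R bs.

(** The bound on [j] keeps the inequality strict: all borders beyond [size bs] equal [+oo]. *)
Lemma border_lt (j k : nat) : (j < k)%N -> (j <= size bs)%N ->
  (border bs j < border bs k)%O.
Proof.
move=> jk jb; case: borderP => hj; case: borderP => hk; try by [|lia].
move: j k jk jb hj hk => [|j] [|k] // jk jb _ hk; rewrite bnd_simp.
exact: (sorted_ltn_nth lt_trans _ hbs).
Qed.

Lemma border_le (j k : nat) : (j <= k)%N -> (border bs j <= border bs k)%O.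
Proof.
rewrite leq_eqVlt => /orP[/eqP -> //|jk].
have [jb|jb] := leqP j (size bs); first by rewrite ltW // border_lt.
by case: (borderP k) => [|hk|_]; rewrite ?bnd_simp //; lia.
Qed.

Lemma right_of_le (j k : nat) (t : int * int) :
  (j <= k)%N -> right_of k t -> right_of j t.
Proof. by move=> /border_le; apply: le_trans. Qed.

(** A tile on border [k] has column at most [b_k], which is less than [b_j] if [k < j]. *)
Lemma right_of_on_border (j k : nat) (t : int * int) :
  right_of j t -> on_border k t -> (j <= k)%N.
Proof.
move=> jt kt; rewrite leqNgt; apply/negP => /border_lt.
case/andP: (on_border_range _ _ kt) => _ kb /(_ kb) /lt_le_trans /(_ jt).
by move: kt; rewrite /on_border; case: borderP => // _; rewrite !eq_BLeft !bnd_simp; lia.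
Qed.

(** If [j < k], integrality gives [b_j <= b_k - 1], so a tile left of border [j] has column at most
    [b_k - 2] and misses both columns along border [k]. *)
Lemma left_of_on_border (j k : nat) (t : int * int) :
  ~~ right_of j t -> on_border k t -> (k <= j)%N.
Proof.
rewrite /right_of -ltNge => jt kt; rewrite leqNgt; apply/negP => jk.
have jb : (j <= size bs)%N by case/andP: (on_border_range _ _ kt); lia.
move: (border_lt _ _ jk jb) jt kt; rewrite /on_border.
by case: borderP => // _; case: borderP => // _; rewrite !eq_BLeft !bnd_simp; lia.
Qed.

(** * The loop invariant and its preservation *)

Section Invariant.
Variables (S : {fset int * int}) (mu : nat).

(* Closed under the edges that cross none of the borders B_1, ..., B_i. *)
Definition closed_upto (i : nat) (D : {fset int * int}) : Prop :=
  forall p q, p \in D -> q \in S -> neighbor p q ->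
    (forall k, (k <= i)%N -> right_of k p = right_of k q) -> q \in D.

(* A candidate is either a join of clusters to the right of B_i or a per-slice
   cluster not yet processed.  Hence a joined cluster that does not touch B_i
   touches no B_k with k < i either, and nothing is lost by dropping it from C_b. *)
Record candidate_inv (i : nat) (D : {fset int * int}) : Prop := {
  cand_closed : closed_upto i D;
  cand_range : (forall t, t \in D -> right_of i t) \/
    exists2 k, (k <= i)%N & forall t, t \in D -> right_of k.-1 t && ~~ right_of k t;
  cand_touches : exists2 k, (k <= i)%N & touches bs k D
}.

(** [inv_cover_cand] ensures that every edge crossing the next border ends in a candidate, so that
    the join sees it. [inv_cover] ensures that no border tile is lost once its cluster leaves the
    candidate set. *)
Record state_inv (i : nat) (st : state) : Prop := {
  inv_cand : forall D, D \in candidates st -> candidate_inv i D;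
  inv_joined : forall D, D \in joined st -> closed_upto 0 D;
  inv_cover_cand : forall t k, t \in S -> (k <= i)%N -> on_border k t ->
    exists2 D, D \in candidates st & t \in D;
  inv_cover : forall t k, t \in S -> on_border k t ->
    exists2 D, D \in candidates st `|` joined st & t \in D
}.

(** The only new edges are those crossing border [i.+1], and both ends of such an edge lie on that
    border by [neighbor_cross]. *)
Lemma closed_upto_pred (i : nat) (D : {fset int * int}) :
  closed_upto i.+1 D ->
  (forall p q, p \in D -> q \in S -> neighbor p q -> on_border i.+1 p ->
     on_border i.+1 q -> q \in D) ->
  closed_upto i D.
Proof.
move=> Dc Db p q pD qS pq eqr.
case: (eqVneq (right_of i.+1 p) (right_of i.+1 q)) => [e|/(neighbor_cross _ _ _ pq)].
  by apply: Dc pD qS pq _ => k; rewrite leq_eqVlt ltnS => /orP[/eqP ->|/eqr].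
by case/andP; apply: Db.
Qed.

(** An edge leaving [D] cannot cross border [i], since its end in [D] would then lie on that border.
    Its other end is therefore also right of border [i], hence right of all earlier borders, and the
    edge crosses none of them. *)
Lemma closed_upto0 (i : nat) (D : {fset int * int}) :
  closed_upto i D -> (forall t, t \in D -> right_of i t) -> ~~ touches bs i D ->
  closed_upto 0 D.
Proof.
move=> Dc Di Dt p q pD qS pq _; apply: (Dc p q) => // k ki.
case: (eqVneq (right_of i p) (right_of i q)) => [|/(neighbor_cross _ _ _ pq) /andP[pi _]].
  by rewrite Di // => /esym qi; rewrite !(right_of_le _ _ _ ki) // Di.
by case/touchesP: Dt; exists p.
Qed.

Lemma step1_inv : state_inv (size bs) (step1 S mu bs).
Proof.
have cover t k : t \in S -> on_border k t ->
    exists2 D, D \in candidates (step1 S mu bs) & t \in D.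
  move=> tS kt; have [j jb tj] := mem_some_slice _ _ tS.
  have tD := mem_component [` tj]; exists (component [` tj]) => //=.
  rewrite in_fset inE /=; apply/andP; split.
    apply/bigfcupP; exists j; first by rewrite mem_iota andbT; lia.
    by apply/clustersP; exists [` tj].
  apply/hasP; exists k; last by apply/touchesP; exists t.
  by have := on_border_range _ _ kt; rewrite mem_iota; lia.
split => [D|//|t k tS _|t k tS /cover]; last 2 first.
- exact: cover.
- by case=> // D Dc tD; exists D => //; rewrite in_fsetU Dc.
rewrite in_fset inE /= => /andP[/bigfcupP[k]].
rewrite andbT mem_iota add1n ltnS => /andP[k0 kb] /clustersP[p ->] /hasP[j].
rewrite mem_iota => jb tj.
have inslice t : t \in component p -> t \in slice bs S k.
  exact: (fsubsetP (component_sub p)).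
split; last by exists j => //; lia.
- move=> x y xD yS xy eqr; apply: (component_closed p x y) => //.
  move: (inslice _ xD); rewrite !mem_slice yS => /and3P[_ xk kx].
  (* The hypothesis [eqr] covers borders up to [size bs] only; the right end of the last slice is
     [+oo] and is treated apart. *)
  have [kb'|kb'] := leqP k (size bs).
    by rewrite -!eqr ?xk // (leq_trans (leq_pred k)).
  have -> : k = (size bs).+1 by apply/eqP; rewrite eqn_leq kb.
  rewrite right_of_last -eqr //= andbT.
  by apply: (right_of_le _ k.-1); lia.
(* Clusters of the last slice are right of the last border and take the first alternative of
   [cand_range]; those of any other slice take the second. *)
- have [kb'|kb'] := leqP k (size bs).
    right; exists k => // t /inslice.
    by rewrite mem_slice => /and3P[_ -> ->].
  left=> t /inslice; rewrite mem_slice => /and3P[_ + _].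
  by apply: right_of_le; lia.
Qed.

Lemma step2_inv (i : nat) (st : state) :
  state_inv i.+1 st -> state_inv i (step2 mu bs st i.+1).
Proof.
case=> candP joinP covC covJ.
set Clr := [fset C in candidates st | touches bs i.+1 C].
have ClrP D : (D \in Clr) = (D \in candidates st) && touches bs i.+1 D.
  by rewrite in_fset inE.
have Js : forall J, (J \in join_clusters Clr) = (J \in join_seq #|` Clr| Clr).
  by move=> J; rewrite in_fset.
have [cov uni clo] := join_seqP #|` Clr| Clr (leqnn _).
have rangeClr D : D \in Clr -> forall t, t \in D -> right_of i t.
  rewrite ClrP => /andP[/candP[_ + _]] /touchesP[s sD si].
  case=> [Di|[k ki Dk]] t tD; first exact: right_of_le (Di t tD).
  (* A per-slice cluster of slice [k] touching border [i.+1] has [i.+1 <= k]; together with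
     [k <= i.+1] it lies in slice [i.+1], just right of border [i]. *)
  have /andP[_ /left_of_on_border /(_ si) ik] := Dk s sD.
  have ki' : k = i.+1 by lia.
  by have /andP[] := Dk t tD; rewrite ki'.
have rangeJ J : J \in join_clusters Clr -> forall t, t \in J -> right_of i t.
  by rewrite Js => JJ t tJ; have [D DC [tD _]] := uni J t JJ tJ; apply: rangeClr tD.
have closedJ J : J \in join_clusters Clr -> closed_upto i J.
  rewrite Js => JJ; apply: closed_upto_pred.
    move=> p q pJ qS pq eqr; have [D] := uni J p JJ pJ.
    rewrite ClrP => /andP[/candP[Dc _ _] _] [pD /fsubsetP]; apply.
    exact: Dc pq eqr.
  (* The far end [q] of an edge crossing border [i.+1] belongs to a candidate touching this border,
     hence to a cluster taking part in the join. *)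
  move=> p q pJ qS pq _ qi; have [D Dc qD] := covC q i.+1 qS (leqnn _) qi.
  apply: (clo J p D q) => //; rewrite ClrP Dc /=.
  by apply/touchesP; exists q.
have candE D : D \in candidates (step2 mu bs st i.+1) =
    (D \in candidates st) && ~~ touches bs i.+1 D ||
    (D \in join_clusters Clr) && touches bs i D.
  rewrite /= in_fsetU in_fsetD -/Clr ClrP negb_and in_fset inE /=.
  by case: (D \in candidates st); rewrite ?andbF ?andbT.
have joinE D : D \in joined (step2 mu bs st i.+1) =
    (D \in joined st) || (D \in join_clusters Clr) && ~~ touches bs i D.
  by rewrite /= in_fsetU in_fset inE.
have cov2 t D : D \in candidates st -> t \in D ->
    D \in candidates (step2 mu bs st i.+1) \/
    exists2 J, J \in join_clusters Clr & t \in J.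
  move=> Dc tD; rewrite candE Dc /=.
  case: (boolP (touches _ _ _)) => [Dt|_]; last by left.
  have [|J JJ /fsubsetP DJ] := cov D; first by rewrite ClrP Dc.
  by right; exists J; rewrite ?Js //; apply: DJ.
split.
- move=> D; rewrite candE => /orP[/andP[/candP[Dc Dr Dt] nt]|/andP[DJ Dt]].
    split.
    + apply: closed_upto_pred Dc _ => p q pD _ _ pi _.
      by case/touchesP: nt; exists p.
    + case: Dr => [Di|[k ki Dk]].
        by left=> t /Di; apply: right_of_le.
      (* An untouched per-slice cluster of slice [i.+1] switches to the first alternative, as its
         left end is border [i]. *)
      move: ki; rewrite leq_eqVlt => /orP[/eqP ki|ki].
        by left=> t /Dk /andP[]; rewrite ki.
      by right; exists k.
    + case: Dt => k; rewrite leq_eqVlt => /orP[/eqP ->|]; first by rewrite (negPf nt).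
      by exists k.
  split; [exact: closedJ|by left; apply: rangeJ|by exists i].
- move=> D; rewrite joinE => /orP[/joinP //|/andP[DJ Dt]].
  exact: closed_upto0 (closedJ _ DJ) (rangeJ _ DJ) Dt.
- move=> t k tS ki kt.
  have [D Dc tD] := covC t k tS (leqW ki) kt.
  case: (cov2 t D Dc tD) => [|[J JJ tJ]]; first by exists D.
  exists J => //; rewrite candE JJ /=; apply/orP; right; apply/touchesP; exists t => //.
  (* [J] lies right of border [i], so a tile of [J] on border [k <= i] forces [k = i]; thus [J]
     touches border [i] and is returned as a candidate. *)
  have ik := right_of_on_border _ _ _ (rangeJ J JJ t tJ) kt.
  by have <- : k = i by lia.
- move=> t k tS kt; have [D + tD] := covJ t k tS kt.
  rewrite in_fsetU => /orP[/cov2 /(_ tD)|Dj].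
    case=> [Dc|[J JJ tJ]]; first by exists D; rewrite // in_fsetU Dc.
    exists J => //; rewrite in_fsetU joinE candE JJ /=.
    by case: (touches bs i J); rewrite !orbT.
  by exists D => //; rewrite in_fsetU joinE Dj orbT.
Qed.

Lemma praster_inv : state_inv 0 (praster S mu bs).
Proof.
rewrite /praster; move: (step1 _ _ _) step1_inv; elim: (size bs) => // n IH st hst.
(* Splitting off the last index of [iota] exposes border [n.+1] as the first one processed by the
   fold. *)
by rewrite -(addn1 n) iotaD rev_cat add1n /=; apply/IH/step2_inv.
Qed.

End Invariant.
End Borders.

Theorem theorem2 (S : {fset int * int}) (mu : nat) (bs : seq int)
    (hbs : sorted <%R bs)
    (r : nat) (C : 'I_r -> {fset int * int}) (sl : 'I_r -> nat)
    (hsl : forall j, (1 <= sl j <= (size bs).+1)%N)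
    (hC : forall j, C j \in clusters (slice bs S (sl j)))
    (several : exists j1 j2, sl j1 != sl j2)
    (hconn : connected (\bigcup_(j in 'I_r) C j)) :
  exists J, J \in joined (praster S mu bs) /\ forall j, C j `<=` J.
Proof.
set U := \bigcup_(j in 'I_r) C j in hconn.
have CU j t : t \in C j -> t \in U.
  by move=> tC; apply/bigfcupP; exists j => //; rewrite mem_index_enum.
have Cslice j t : t \in C j -> t \in slice bs S (sl j).
  by have /clustersP[p ->] := hC j; apply/fsubsetP/component_sub.
have US t : t \in U -> t \in S.
  by case/bigfcupP => j _ /Cslice; rewrite mem_slice => /andP[].
have Cne j : exists t, t \in C j.
  by have /clustersP[p ->] := hC j; exists (val p); apply: mem_component.
have Uind (P : int * int -> Prop) :
    (forall x y, x \in U -> y \in U -> neighbor x y -> P x -> P y) ->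
    forall x y, x \in U -> y \in U -> P x -> P y.
  move=> PU x y xU yU; have := hconn [` xU] [` yU].
  apply: (@connect_ind _ _ (fun z : U => P (val z))) => p q.
  by apply: PU; apply: valP.
have [t [k [tU kt]]] : exists t k, t \in U /\ on_border bs k t.
  have [j1 [j2 lt12]] : exists j1 j2, (sl j1 < sl j2)%N.
    case: several => j1 [j2]; rewrite neq_ltn => /orP[]; first by exists j1, j2.
    by exists j2, j1.
  have [[p pC] [q qC]] := (Cne j1, Cne j2).
  have := Cslice _ _ pC; have := Cslice _ _ qC.
  rewrite !mem_slice => /and3P[_ qj _] /and3P[_ _ pj].
  have qr : right_of bs (sl j1) q by apply: right_of_le qj; lia.
  (* [P] is propagated along a path in [U] from [p], left of border [sl j1], to [q], right of it:
     the first step across this border yields a border tile. *)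
  pose P x := ~~ right_of bs (sl j1) x \/
    exists t k, t \in U /\ on_border bs k t.
  case: (Uind P _ p q (CU _ _ pC) (CU _ _ qC)); [|by left|by rewrite qr|by []].
  move=> x y xU yU xy [xl|]; last by right.
  case: (boolP (right_of bs (sl j1) y)) => [yr|]; last by left.
  right; exists x, (sl j1); split=> //.
  have := neighbor_cross bs (sl j1) _ _ xy.
  by rewrite yr (negPf xl) => /(_ isT) /andP[].
have [cand joi _ /(_ t k (US _ tU) kt)] := praster_inv bs hbs S mu.
(* A remaining candidate would touch a border of index at most [0], that is [b_0 = -oo], which no
   tile touches; so [J] is a joined cluster. *)
case=> J; rewrite in_fsetU => /orP[/cand[_ _ [j + jJ]]|Jj] tJ.
  by move: jJ => /touchesP[s _ /on_border_range]; case: j.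
exists J; split=> // j; apply/fsubsetP => s /CU sU.
(* Membership in [J] spreads from [t] through [U], because [closed_upto 0] restricts edges only at
   border [0], which every tile is right of. *)
apply: (Uind (fun x => x \in J) _ t s) => // x y _ yU xy xJ.
by apply: (joi J Jj x y xJ (US _ yU) xy) => l; rewrite leqn0 => /eqP ->.
Qed.
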